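(* Let $b\in\mathbb{N}$ and let $a\in\mathbb{Z}$ be relatively prime to $b$. Let $a^*\in\{1,\dots,b-1\}$ satisfy $aa^*\equiv 1\pmod b$. (a) Let $b$ be odd. If $3\nmid b$, then $bT(a,b)\equiv 9+18\left(\frac{a}{b}\right)-a-a^*\pmod{24}$. If $3\mid b$, then $bT(a,b)\equiv 9+18\left(\frac{a}{b}\right)-16\varepsilon-a-a^*\pmod{72}$. (b) Let $b\equiv 2\pmod 4$, or let both $b\equiv 0\pmod 4$ and $a\equiv 3\pmod 4$ hold. If $3\nmid b$, then $bT(a,b)\equiv 6-a-a^*\pmod{24}$. If $3\mid b$, then $bT(a,b)\equiv 54-16\varepsilon-a-a^*\pmod{72}$. (c) Let $b\equiv 0\pmod 4$ and $a\equiv 1\pmod 4$. If $3\nmid b$, then $bT(a,b)\equiv 18-a-a^*\pmod{24}$. If $3\mid b$, then $bT(a,b)\equiv 18-16\varepsilon-a-a^*\pmod{72}$.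
   Context: For $a\in\mathbb{Z}$, $b\in\mathbb{N}$ coprime, write the regular continued fraction expansion $a/b=[q_0,q_1,\dots,q_n]$ with $q_0\in\mathbb{Z}$ and $q_1,\dots,q_n\in\mathbb{N}$, where one does not require $q_n\ge 2$ but instead requires $n$ to be odd. Define $T(a,b)=\sum_{k=0}^{n}(-1)^{k-1}q_k$. The symbol $\left(\frac{a}{b}\right)$ denotes the Jacobi symbol. For an integer $a$ with $3\nmid a$, $\varepsilon\in\{1,-1\}$ is defined by $a\equiv\varepsilon\pmod 3$. *)

(* Defs.v *)
From HB Require Import structures.
From mathcomp Require Import all_boot all_order all_algebra.
From mathcomp Require Import zify ring lra.
Set Implicit Arguments. Unset Strict Implicit. Unset Printing Implicit Defensive.
Import Order.TTheory GRing.Theory Num.Theory.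
Local Open Scope ring_scope.

(* The value [q_0, q_1, ..., q_n] of a continued fraction. As 0^-1 = 0 in rat,
   the one-term fraction [q_0] has value q_0. *)
Fixpoint cf_val (q : seq int) : rat :=
  if q is x :: q' then x%:~R + (cf_val q')^-1 else 0.

(* Here n = (size q).-1, so that oddness of n excludes the empty sequence. *)
Definition odd_regular_cf (a : int) (b : nat) (q : seq int) : bool :=
  [&& odd (size q).-1, all (fun x => 0 < x) (behead q)
    & cf_val q == a%:~R / b%:R].

Lemma regular_cf_ex (b : nat) (a : int) (p : bool) : (0 < b)%N ->
  exists q : seq int, [/\ q != [::], all (fun x => 0 < x) (behead q),
    odd (size q) = p, cf_val q = a%:~R / b%:R & b%:Z < a -> 0 < head 0 q].
Proof.
elim/ltn_ind: b a p => b IH a p b0.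
have bz : (b%:R : rat) != 0 by rewrite pnatr_eq0; lia.
have ea := divz_eq a b.
have rge := @modz_ge0 a b ltac:(lia).
have rlt := @ltz_pmod a b ltac:(lia).
set m := (a %/ b)%Z in ea; set r := (a %% b)%Z in ea rge rlt.
have ab : a%:~R / b%:R = m%:~R + r%:~R / b%:R :> rat.
  by rewrite ea intrD intrM mulrDl /= -pmulrn mulfK.
have [r0|r0] := eqVneq r 0.
  rewrite ab r0 mul0r addr0; case: p.
    by exists [:: m]; split => //=; [rewrite invr0 addr0 | nia].
  exists [:: m - 1; 1]; split => //=; last nia.
  by rewrite invr0 addr0 invr1 rmorphB /= subrK.
have [k rk] : exists k : nat, r = k%:Z by exists `|r|%N; lia.
have [q [q0 qp qs qv qh]] := IH k ltac:(lia) b%:Z (~~ p) ltac:(lia).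
exists (m :: q); split => //=; last nia.
- case: q q0 qp qh {qs qv} => //= x q _ -> ->; lia.
- by rewrite qs negbK.
- by rewrite qv ab rk invf_div -!pmulrn.
Qed.

(* Unconditional: for b = 0 the quotient a / b is 0 = [-1, 1] in rat. *)
Lemma odd_regular_cf_ex (a : int) (b : nat) : exists q, odd_regular_cf a b q.
Proof.
case: b => [|b].
  by exists [:: -1; 1]; rewrite /odd_regular_cf /= invr0 mulr0.
have [q [q0 qp qs qv _]] := @regular_cf_ex b.+1 a false isT.
exists q; rewrite /odd_regular_cf qp qv eqxx !andbT.
by case: q q0 qs {qp qv} => //= x q _ /negbFE.
Qed.

Lemma cf_val_ge1 (q : seq int) : q != [::] -> all (fun x => 0 < x) q ->
  1 <= cf_val q ?= iff (q == [:: 1]).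
Proof.
elim: q => //= x q IH _ /andP[x0 qp].
have x1 : 1 <= (x%:~R : rat) by rewrite ler1z; lia.
have [->|qn] := eqVneq q [::].
  rewrite /= invr0 addr0; apply/leifP; rewrite eqseq_cons andbT.
  case: eqVneq => [->//|xn]; rewrite ltr1z; lia.
have [q1 _] := IH qn qp.
have vi : 0 < (cf_val q)^-1 by rewrite invr_gt0; lra.
apply/leifP; rewrite eqseq_cons (negPf qn) andbF; lra.
Qed.

Lemma regular_cf_uniq (q q' : seq int) :
  q != [::] -> q' != [::] -> odd (size q) = odd (size q') ->
  all (fun x => 0 < x) (behead q) -> all (fun x => 0 < x) (behead q') ->
  cf_val q = cf_val q' -> q = q'.
Proof.
have aux (x y : int) (u v : rat) :
    x%:~R + u = y%:~R + v -> 0 <= u <= 1 -> 0 <= v <= 1 ->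
    (u < 1) || (0 < v) -> (0 < u) || (v < 1) -> x = y.
  move=> e hu hv h1 h2.
  have : (x - y)%:~R < (1 : rat) by rewrite rmorphB /=; case/orP: h2; lra.
  have : (y - x)%:~R < (1 : rat) by rewrite rmorphB /=; case/orP: h1; lra.
  rewrite !ltrz1; lia.
have inv01 (t : seq int) : all (fun x => 0 < x) t ->
    0 <= (cf_val t)^-1 <= 1 /\ (t != [::] -> 0 < (cf_val t)^-1).
  move=> tp; have [->|tn] := eqVneq t [::]; first by rewrite /= invr0.
  have [t1 _] := cf_val_ge1 tn tp.
  have t0 : 0 < (cf_val t)^-1 by rewrite invr_gt0; lra.
  by split => //; rewrite ltW //= invf_le1 //; lra.
have lt1 (t : seq int) : all (fun x => 0 < x) t -> ~~ odd (size t) ->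
    (cf_val t)^-1 < 1.
  case: t => [|x t] tp ts; first by rewrite /= invr0.
  have /leifP := cf_val_ge1 (isT : x :: t != [::]) tp.
  case: eqVneq => [e|_ h]; first by rewrite e in ts.
  by rewrite invf_lt1 //; lra.
elim: q q' => // x q IH [//|y q'] _ _ /= /negb_inj os qp qp' e.
have [hq hq0] := inv01 q qp; have [hq' hq0'] := inv01 q' qp'.
have [qn|qn] := eqVneq q [::]; have [qn'|qn'] := eqVneq q' [::].
- subst; congr (_ :: _).
  by move: e; rewrite /= invr0 !addr0 => /intr_inj.
- have xy : x = y.
    apply: (aux _ _ _ _ e) => //; first by rewrite hq0' // orbT.
    by rewrite lt1 ?orbT // -os qn.
  have := hq0' qn'; move: e; rewrite xy qn /= invr0 => /addrI <-.
  by rewrite ltxx.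
- have xy : x = y.
    apply: (aux _ _ _ _ e) => //; last by rewrite hq0.
    by rewrite lt1 // os qn'.
  have := hq0 qn; move: e; rewrite xy qn' /= invr0 => /addrI ->.
  by rewrite ltxx.
- have xy : x = y by apply: (aux _ _ _ _ e); rewrite ?hq0 ?hq0' ?orbT.
  congr (_ :: _) => //; apply: IH => //.
  + by case: (q) qp => //= ? ? /andP[].
  + by case: (q') qp' => //= ? ? /andP[].
  + by move: e; rewrite xy => /addrI/invr_inj.
Qed.

Definition odd_cf (a : int) (b : nat) : seq int := xchoose (odd_regular_cf_ex a b).

Lemma odd_cfP (a : int) (b : nat) (q : seq int) :
  odd_regular_cf a b q <-> q = odd_cf a b.
Proof.
have h := xchooseP (odd_regular_cf_ex a b); split=> [|-> //].
move: h; rewrite -/(odd_cf a b) => /and3P[o1 p1 /eqP v1] /and3P[o2 p2 /eqP v2].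
apply: regular_cf_uniq => //; last by rewrite v1 v2.
- by case: (q) o2.
- by case: odd_cf o1.
- by case: (q) o2 => //= ? ? ->; case: odd_cf o1 => //= ? ? ->.
Qed.

(* The sign (-1)^(k-1) is written (-1)^(k+1) to keep a natural exponent. *)
Definition T (a : int) (b : nat) : int :=
  \sum_(k < size (odd_cf a b)) (-1) ^+ k.+1 * (odd_cf a b)`_k.

(* Legendre symbol; only meaningful for an odd prime p. *)
Definition legendre (a : int) (p : nat) : int :=
  if (p%:Z %| a)%Z then 0
  else if [exists x : 'I_p, (x%:Z ^+ 2 == a %[mod p%:Z])%Z] then 1 else -1.

(* Jacobi symbol (a / b) for odd b > 0; prime_decomp lists the pairs (p, e) with
   p ^ e exactly dividing b. *)
Definition jacobi (a : int) (b : nat) : int :=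
  \prod_(pe <- prime_decomp b) legendre a pe.1 ^+ pe.2.

(* Main.v *)
Require Import Defs.
From mathcomp Require Import all_boot all_order all_algebra.
From mathcomp Require Import zify ring.
Set Implicit Arguments. Unset Strict Implicit. Unset Printing Implicit Defensive.
Import Order.TTheory GRing.Theory Num.Theory.
Local Open Scope ring_scope.

(** Grouping the partial quotients of a/b = [q_0, ..., q_n] in pairs writes the
    matrix (a c; b d) of its last two convergents as the product
    U^q_0 L^q_1 U^q_2 ... L^q_n with U = (1 1; 0 1) and L = (1 0; 1 1); here
    d = a* because a d - b c = 1 and 0 < d <= b. Left multiplication by U lowers
    T by 1 and by L raises it by 1, so T can be followed one generator at a time.
    Modulo 3, T is a polynomial in a, b, c, d. Modulo 8 it is given for odd b by
    T = b (1 + 2 (a/b) - a - d), and for even b by the same formula applied to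
    L (a c; b d), whose lower left entry a + b is odd. That these formulas are
    preserved follows from quadratic reciprocity for the Jacobi symbol (proved by
    Gauss's lemma and Eisenstein's lattice count), the value of (-1/b), and a
    finite check over SL_2(Z/8). When b is divisible by 3, b T modulo 9 is
    determined by T modulo 3. *)

(** * The Legendre symbol through Euler's criterion *)

Lemma Fp_int_eq0 (p : nat) (a : int) : prime p ->
  (a%:~R == 0 :> 'F_p) = (p%:Z %| a)%Z.
Proof. by move=> p_pr; rewrite (dvdz_pcharf (pchar_Fp p_pr)). Qed.

Lemma Fp_nat_eq0 (p n : nat) : prime p -> (n%:R == 0 :> 'F_p) = (p %| n)%N.
Proof. by move=> p_pr; rewrite (dvdn_pcharf (pchar_Fp p_pr)). Qed.

Lemma Fp_int_eq (p : nat) (a b : int) : prime p ->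
  (a%:~R == b%:~R :> 'F_p) = (a == b %[mod p%:Z])%Z.
Proof. by move=> p_pr; rewrite -subr_eq0 -rmorphB Fp_int_eq0 // eqz_mod_dvd. Qed.

Lemma Fp_fermat (p : nat) (x : 'F_p) : prime p -> x != 0 -> x ^+ p.-1 = 1.
Proof.
move=> p_pr x0; apply: (mulfI x0); rewrite -exprS prednK ?prime_gt0 // mulr1.
have [n ->] : exists n : nat, x = n%:R by exists x; rewrite natr_Zp.
by rewrite -[RHS]Fp_nat_mod // -fermat_little // Fp_nat_mod // natrX.
Qed.

Lemma odd_prime_half (p : nat) : prime p -> odd p ->
  p = (p./2.*2).+1 /\ (0 < p./2)%N.
Proof. by move=> /prime_gt1 p1 p_odd; split; lia. Qed.

(** By Fermat, the [p./2] nonzero squares are roots of ['X^h - 1]. A nonsquare [a] with [a ^ h = 1]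
    would be one root more than the degree allows, so its power is -1. *)
Lemma legendre_euler (a : int) (p : nat) : prime p -> odd p ->
  (legendre a p)%:~R = a%:~R ^+ p./2 :> 'F_p.
Proof.
move=> p_pr p_odd; have [pE h0] := odd_prime_half p_pr p_odd.
set h := p./2 in pE h0 *; rewrite /legendre -Fp_int_eq0 //.
have p1E : (h * 2)%N = p.-1 by lia.
case: eqVneq => [->|a0]; first by rewrite expr0n; case: (h) h0.
case: existsP => [[x]|nsq].
  rewrite -Fp_int_eq // => /eqP ax; move: a0.
  rewrite -ax rmorphXn /= expf_eq0 /= => x0.
  by rewrite -exprM mulnC p1E Fp_fermat.
have := Fp_fermat p_pr a0; rewrite -p1E exprM => /eqP.
rewrite sqrf_eq1 => /orP[/eqP y1|/eqP->//].
have nz : 'X^h - 1 != 0 :> {poly 'F_p} by rewrite -size_poly_eq0 size_XnsubC.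
pose sq k : 'F_p := k.+1%:R ^+ 2.
have := max_poly_roots (rs := a%:~R :: [seq sq k | k <- iota 0 h]) nz.
rewrite size_XnsubC // /= size_map size_iota ltnn => H; exfalso.
suff : false by []; apply: H.
  apply/andP; split; first by rewrite rootE !hornerE y1 subrr.
  apply/allP => y /mapP[k]; rewrite mem_iota => /andP[_ kh] ->.
  rewrite rootE !hornerE -exprM mulnC p1E Fp_fermat ?subrr //.
  by rewrite Fp_nat_eq0 // gtnNdvd //; lia.
apply/andP; split.
  apply/negP => /mapP[k]; rewrite mem_iota => /andP[_ kh] ak; apply: nsq.
  have kp : (k.+1 < p)%N by lia.
  by exists (Ordinal kp); rewrite -Fp_int_eq // ak /sq rmorphXn /= -pmulrn.
(* Equal squares force equal or opposite roots; opposite ones are excluded because [k.+1 + l.+1]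
   lies strictly between 0 and p. *)
rewrite map_inj_in_uniq ?iota_uniq // => k l; rewrite !mem_iota => kh lh.
move/eqP; rewrite eqf_sqr => /orP[].
  by rewrite !pmulrn Fp_int_eq // !modz_nat !modn_small; lia.
rewrite -addr_eq0 -natrD Fp_nat_eq0 // gtnNdvd //; lia.
Qed.

Lemma legendre_cases (a : int) (p : nat) :
  [\/ legendre a p = 0, legendre a p = 1 | legendre a p = -1].
Proof.
rewrite /legendre; case: ifP => _; first by constructor 1.
by case: ifP => _; [constructor 2 | constructor 3].
Qed.

(** The values 0, 1, -1 stay distinct modulo p > 2, so an identity between symbols may be checked in
    ['F_p] with Euler's criterion. *)
Lemma legendre_uniq (a x : int) (p : nat) : prime p -> odd p ->
  [\/ x = 0, x = 1 | x = -1] -> x%:~R = a%:~R ^+ p./2 :> 'F_p ->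
  legendre a p = x.
Proof.
move=> p_pr p_odd hx; rewrite -legendre_euler // => /esym/eqP.
have p1 := prime_gt1 p_pr.
rewrite Fp_int_eq // eqz_mod_dvd => /dvdzP[k].
have kp : [\/ k = 0, p%:Z <= k * p%:Z | k * p%:Z <= - p%:Z].
  have [k0|k0|->] := ltgtP k 0; last by constructor 1.
    by constructor 3; nia.
  by constructor 2; nia.
have {p1 p_odd} p2 : (2 < p)%N by move: p1 p_odd; case: (p) => [|[|[]]].
case: kp => [->|kp|kp]; case: hx => ->; case: (legendre_cases a p) => -> //;
  lia.
Qed.

Lemma legendreM (a a' : int) (p : nat) : prime p -> odd p ->
  legendre (a * a') p = legendre a p * legendre a' p.
Proof.
move=> p_pr p_odd; apply: legendre_uniq => //; last first.
  by rewrite !rmorphM /= exprMn !legendre_euler.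
by case: (legendre_cases a p) => ->; case: (legendre_cases a' p) => ->;
  rewrite ?mulr0 ?mul0r ?mulr1 ?mul1r ?mulrNN;
  (constructor 1; reflexivity) || (constructor 2; reflexivity)
  || (constructor 3; reflexivity).
Qed.

Lemma legendreN1 (p : nat) : prime p -> odd p -> legendre (-1) p = (-1) ^+ p./2.
Proof.
move=> p_pr p_odd; apply: legendre_uniq => //.
  by rewrite -signr_odd; case: odd; [constructor 3 | constructor 2].
by rewrite rmorphXn.
Qed.

Lemma eq_legendre (a a' : int) (p : nat) :
  (a = a' %[mod p%:Z])%Z -> legendre a p = legendre a' p.
Proof.
move=> e; rewrite /legendre.
have -> : (p%:Z %| a)%Z = (p%:Z %| a')%Z.
  by apply/dvdz_mod0P/dvdz_mod0P; rewrite e.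
case: ifP => // _; have -> // : [exists x : 'I_p, (x%:Z ^+ 2 == a %[mod p%:Z])%Z]
  = [exists x : 'I_p, (x%:Z ^+ 2 == a' %[mod p%:Z])%Z].
by apply: eq_existsb => x; rewrite e.
Qed.

Lemma legendre_sqr (a : int) (p : nat) : ~~ (p%:Z %| a)%Z ->
  legendre a p ^+ 2 = 1.
Proof. by move=> pa; rewrite /legendre (negPf pa); case: ifP. Qed.

(** * Quadratic reciprocity for primes *)

(** Up to sign, the residues [r k] of q k for k = 1, ..., h are a permutation [f] of 1, ..., h.
    Comparing products gives the sign (-1)^N, where N counts the residues above h; N has the parity
    of the sum of the quotients. *)
Lemma gauss_eisenstein (p q : nat) :
  prime p -> odd p -> odd q -> coprime p q ->
  (q%:R : 'F_p) ^+ p./2 = (-1) ^+ (\sum_(k < p./2) (q * k.+1 %/ p))%N.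
Proof.
move=> p_pr p_odd q_odd pq; have [pE h0] := odd_prime_half p_pr p_odd.
set h := p./2 in pE h0 *.
pose r (k : nat) := ((q * k) %% p)%N.
pose f (k : nat) := if (r k <= h)%N then r k else (p - r k)%N.
have p0 := prime_gt0 p_pr.
have rlt k : (r k < p)%N by rewrite ltn_mod.
have r0 k : (0 < k <= h)%N -> (0 < r k)%N.
  move=> kh; rewrite lt0n; apply/negP; rewrite -/(dvdn p (q * k)).
  by rewrite Gauss_dvdr // gtnNdvd //; lia.
have fb k : (0 < k <= h)%N -> (0 < f k <= h)%N.
  move=> kh; have := r0 k kh; have := rlt k; rewrite /f; case: ifP; lia.
have fF k : (f k)%:R = (-1) ^+ (h < r k)%N * (q%:R * k%:R) :> 'F_p.
  have rF : (r k)%:R = q%:R * k%:R :> 'F_p by rewrite Fp_nat_mod // natrM.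
  rewrite /f ltnNge; case: leqP => _ /=; first by rewrite mul1r.
  by rewrite natrB ?(ltnW (rlt k)) // rF pchar_Fp_0 // sub0r mulN1r.
(* Squaring removes the sign in [fF]; then k = -l modulo p is excluded by 0 < k + l < p. *)
have fI k l : (0 < k <= h)%N -> (0 < l <= h)%N -> f k = f l -> k = l.
  move=> kh lh /(congr1 (fun n => n%:R ^+ 2 : 'F_p)).
  rewrite !fF !exprMn -!exprM !(mulnC _ 2%N) !exprM !sqrrN !expr1n !mul1r.
  have q0 : q%:R ^+ 2 != 0 :> 'F_p.
    by rewrite expf_eq0 /= Fp_nat_eq0 // -prime_coprime.
  move/(mulfI q0)/eqP; rewrite eqf_sqr => /orP[].
    by rewrite !pmulrn Fp_int_eq // !modz_nat !modn_small; lia.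
  rewrite -addr_eq0 -natrD Fp_nat_eq0 // gtnNdvd //; lia.
have gP (k : 'I_h) : ((f k.+1).-1 < h)%N by have := fb k.+1 (ltn_ord k); lia.
pose g k := Ordinal (gP k).
have gS k : (g k).+1 = f k.+1 by have := fb k.+1 (ltn_ord k); rewrite /=; lia.
have gI : injective g.
  move=> k l /(congr1 (fun i => (nat_of_ord i).+1)); rewrite !gS => /fI.
  by move=> /(_ (ltn_ord k) (ltn_ord l)) [] /val_inj.
pose N := (\sum_(k < h) (h < r k.+1)%N)%N.
have EF : (-1) ^+ N * q%:R ^+ h = 1 :> 'F_p.
  pose P := \prod_(k < h) (k.+1%:R : 'F_p).
  have P0 : P != 0.
    apply/prodf_neq0 => k _; rewrite Fp_nat_eq0 // gtnNdvd //.
    have := ltn_ord k; lia.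
  apply: (mulIf P0); rewrite mul1r {2}/P (reindex_inj gI) /=.
  under [RHS]eq_bigr => k _ do rewrite gS fF.
  rewrite big_split /= prodrXr -/N big_split /= -mulrA; congr (_ * (_ * _)).
  by rewrite prodr_const card_ord.
(* As p and q are odd, division with remainder shows that the quotient of q k by p has the parity of
   k + [r k], and [r k] that of [f k] plus the indicator of h < [r k]. Summed over k, the terms k
   and [f k] cancel. *)
have par : odd N = odd (\sum_(k < h) (q * k.+1 %/ p))%N.
  have S0 : (\sum_(k < h) f k.+1 = \sum_(k < h) k.+1)%N.
    by rewrite [RHS](reindex_inj gI); apply: eq_bigr => k _; rewrite gS.
  have oddS (F : 'I_h -> nat) :
      odd (\sum_(k < h) F k)%N = \big[addb/false]_(k < h) odd (F k).
    by apply: (big_morph odd oddD).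
  move: (congr1 odd S0); rewrite /N !oddS => S1.
  have -> : \big[addb/false]_(k < h) odd (q * k.+1 %/ p) =
    \big[addb/false]_(k < h)
      (odd (k.+1) (+) odd (f k.+1) (+) odd (h < r k.+1)%N).
    apply: eq_bigr => k _.
    have /(congr1 odd) := divn_eq (q * k.+1) p.
    rewrite oddD !oddM q_odd p_odd andbT -/(r k.+1) andTb => ->.
    rewrite /f ltnNge; case: leqP => _ /=.
      by rewrite addbF -addbA addbb addbF.
    rewrite oddB ?(ltnW (rlt _)) // p_odd.
    by do 2 case: odd.
  by rewrite !big_split /= S1 addbb.
by rewrite -signr_odd -par signr_odd -[RHS]mulr1 -[X in _ = _ * X]EF signrMK.
Qed.

(** The two sums count the points of a [p./2] by [q./2] grid on either side of the line p l = q k;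
    by coprimality no point lies on it. *)
Lemma eisenstein_lattice (p q : nat) : odd p -> odd q -> coprime p q ->
  (\sum_(k < p./2) (q * k.+1 %/ p) + \sum_(l < q./2) (p * l.+1 %/ q)
   = p./2 * q./2)%N.
Proof.
have count m n : (n <= m -> \sum_(l < m) (l < n) = n)%N.
  elim: m n => [|m IH] n; first by rewrite leqn0 big_ord0 => /eqP.
  rewrite big_ord_recr /= leq_eqVlt => /orP[/eqP->|nm].
    rewrite ltnSn addn1 -[X in _ = X.+1](IH m) //; congr (_.+1).
    by apply: eq_bigr => l _; have := ltn_ord l; lia.
  by rewrite IH //; lia.
have floor p' q' k : odd p' -> odd q' -> (k < p'./2)%N ->
    (q' * k.+1 %/ p' = \sum_(l < q'./2) (p' * l.+1 <= q' * k.+1))%N.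
  move=> op oq kp; have p0 : (0 < p')%N by lia.
  rewrite -[LHS](count q'./2).
    by apply: eq_bigr => l _; rewrite leq_divRL // mulnC.
  (* The quotient does not exceed [q'./2]: twice [k.+1] is at most p' - 1, so q' [k.+1] stays below
     p' (q' + 1) / 2. *)
  rewrite -ltnS ltn_divLR //.
  have : (q' * (k.+1).*2 <= q' * p'.-1)%N by rewrite leq_mul2l; lia.
  nia.
move=> op oq pq.
under eq_bigr => k _ do rewrite (floor p q) //.
under [X in (_ + X)%N]eq_bigr => k _ do rewrite (floor q p) //.
rewrite [X in (_ + X)%N]exchange_big -big_split /=.
under eq_bigr => k _.
  rewrite -big_split /=.
  under eq_bigr => l _.
    have -> : ((p * l.+1 <= q * k.+1) + (q * k.+1 <= p * l.+1) = 1)%N.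
      have ne : (p * l.+1 != q * k.+1)%N.
        apply/eqP => e; have : (q %| p * l.+1)%N by rewrite e dvdn_mulr.
        rewrite Gauss_dvdr 1?coprime_sym // gtnNdvd //.
        by have := ltn_ord l; lia.
      by case: ltngtP ne.
    over.
  rewrite sum1_card card_ord.
  over.
by rewrite sum_nat_const card_ord.
Qed.

Lemma legendre_reciprocity (p q : nat) :
  prime p -> prime q -> odd p -> odd q -> coprime p q ->
  legendre q%:Z p * legendre p%:Z q = (-1) ^+ (p./2 * q./2).
Proof.
have L p' q' : prime p' -> odd p' -> odd q' -> coprime p' q' ->
    legendre q'%:Z p' = (-1) ^+ (\sum_(k < p'./2) (q' * k.+1 %/ p'))%N.
  move=> p_pr op oq pq; apply: legendre_uniq => //.
    by rewrite -signr_odd; case: odd; [constructor 3 | constructor 2].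
  by rewrite -pmulrn gauss_eisenstein // rmorphXn.
move=> p_pr q_pr op oq pq; rewrite (L p q) // (L q p) 1?coprime_sym //.
by rewrite -exprD eisenstein_lattice.
Qed.

(** * The Jacobi symbol and its reciprocity law *)

(** An index range shared by several b makes multiplicativity in b a termwise statement about
    [logn]; nonprime p contribute exponent 0. *)
Lemma jacobiE (a : int) (b N : nat) : (b < N)%N ->
  jacobi a b = \prod_(0 <= p < N) legendre a p ^+ logn p b.
Proof.
move=> bN; rewrite /jacobi prime_decompE big_map /=.
rewrite (perm_big [seq p <- index_iota 0 N | p \in primes b]) /=; last first.
  apply: uniq_perm; rewrite ?primes_uniq ?filter_uniq ?iota_uniq // => p.
  rewrite mem_filter mem_index_iota /=; case: (boolP (p \in primes b)) => //=.
  by rewrite mem_primes => /and3P[_ b0 /(dvdn_leq b0)]; lia.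
rewrite big_filter big_mkcond /=; apply: eq_bigr => p _.
rewrite mem_primes lognE; case: prime => //=.
by case: ((0 < b)%N && _).
Qed.

Lemma jacobiMr (a : int) (m n : nat) : (0 < m)%N -> (0 < n)%N ->
  jacobi a (m * n) = jacobi a m * jacobi a n.
Proof.
move=> m0 n0; have mn : (m < (m * n).+1 /\ n < (m * n).+1)%N by nia.
rewrite !(@jacobiE _ _ (m * n).+1) //; try by case: mn.
by rewrite -big_split; apply: eq_bigr => p _; rewrite lognM // exprD.
Qed.

Lemma jacobi1 (a : int) : jacobi a 1 = 1.
Proof. by rewrite /jacobi big_nil. Qed.

Lemma jacobi_prime (a : int) (p : nat) : prime p -> jacobi a p = legendre a p.
Proof.
move=> p_pr; rewrite /jacobi prime_decompE primes_prime //= big_seq1 /=.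
by rewrite logn_prime // eqxx.
Qed.

Lemma odd_prime_ind (P : nat -> Prop) : P 1%N ->
  (forall p m, prime p -> odd p -> odd m -> P m -> P (p * m)%N) ->
  forall n, odd n -> P n.
Proof.
move=> P1 PM; elim/ltn_ind => n IH on.
have [n1|n1] := leqP n 1; first by have -> : n = 1%N by lia.
have [p p_pr /dvdnP[m nE]] := pdivP n1.
move: on; rewrite nE oddM mulnC => /andP[om op]; apply: PM => //.
by apply: IH => //; have := prime_gt1 p_pr; nia.
Qed.

Lemma jacobiM (a a' : int) (b : nat) : odd b ->
  jacobi (a * a') b = jacobi a b * jacobi a' b.
Proof.
move: b; apply: odd_prime_ind => [|p m p_pr op om IH]; first by rewrite !jacobi1.
have [p0 m0] : (0 < p /\ 0 < m)%N by lia.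
by rewrite !jacobiMr // !(jacobi_prime _ p_pr) legendreM // IH mulrACA.
Qed.

Lemma eq_jacobi (a a' : int) (b : nat) : (a = a' %[mod b%:Z])%Z ->
  jacobi a b = jacobi a' b.
Proof.
move=> e; rewrite /jacobi prime_decompE [LHS]big_map [RHS]big_map /=.
apply: eq_big_seq => p; rewrite mem_primes => /and3P[_ _ pb].
congr (_ ^+ _); apply: eq_legendre; apply/eqP.
rewrite eqz_mod_dvd; apply: (dvdz_trans (n := b%:Z)) => //.
by rewrite -eqz_mod_dvd e.
Qed.

(** This makes (-1)^((b-1)/2) multiplicative in odd b, as the sign rules for the Jacobi symbol
    require. *)
Lemma odd_halfM (m n : nat) : odd m -> odd n ->
  odd (m * n)./2 = odd m./2 (+) odd n./2.
Proof.
move=> om on; have [mE nE] : m = (m./2.*2).+1 /\ n = (n./2.*2).+1 by lia.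
set m' := m./2 in mE *; set n' := n./2 in nE *.
have -> : ((m * n)./2 = (m' * n').*2 + (m' + n'))%N by rewrite mE nE; nia.
by rewrite oddD odd_double oddD.
Qed.

Lemma jacobiN1 (b : nat) : odd b -> jacobi (-1) b = (-1) ^+ (odd b./2).
Proof.
move: b; apply: odd_prime_ind => [|p m p_pr op om IH]; first by rewrite !jacobi1.
have [p0 m0] : (0 < p /\ 0 < m)%N by lia.
by rewrite jacobiMr // jacobi_prime // legendreN1 // IH odd_halfM // signr_addb
  !signr_odd.
Qed.

Lemma jacobi_sqr (a : int) (b : nat) : odd b -> coprimez a b%:Z ->
  jacobi a b ^+ 2 = 1.
Proof.
move: b; apply: odd_prime_ind => [|p m p_pr op om IH]; first by rewrite !jacobi1.
have [p0 m0] : (0 < p /\ 0 < m)%N by lia.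
rewrite PoszM coprimezMr => /andP[ap am].
rewrite jacobiMr // jacobi_prime // exprMn IH // legendre_sqr //.
by move: ap; rewrite coprimez_sym coprimezE /= prime_coprime.
Qed.

Lemma jacobi_sign (a : int) (b : nat) : odd b -> coprimez a b%:Z ->
  jacobi a b = 1 \/ jacobi a b = -1.
Proof.
move=> ob ab; have /eqP := jacobi_sqr ob ab.
by rewrite sqrf_eq1 => /orP[] /eqP; [left | right].
Qed.

(** Both sides are multiplicative in a and in b, so splitting off prime factors of a, then of b,
    reduces to two primes. *)
Lemma jacobi_reciprocity (a b : nat) : odd a -> odd b -> coprime a b ->
  jacobi b%:Z a * jacobi a%:Z b = (-1) ^+ (odd a./2 && odd b./2).
Proof.
have jacobi1l n : odd n -> jacobi 1 n = 1.
  move=> on; have := jacobi_sqr (a := 1) on; rewrite coprimezE coprime1n.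
  move/(_ isT).
  by rewrite expr2 -jacobiM // mulr1.
move=> oa ob; move: a oa b ob.
apply: odd_prime_ind => [b ob _|p m p_pr op om IHm].
  by rewrite jacobi1 jacobi1l.
have [p0 m0] : (0 < p /\ 0 < m)%N by lia.
move=> b ob; rewrite coprimeMl => /andP[pb mb].
rewrite jacobiMr // PoszM jacobiM // mulrACA IHm // odd_halfM //.
rewrite andb_addl signr_addb jacobi_prime //; congr (_ * _).
move: b ob pb {mb}; apply: odd_prime_ind => [_|q n q_pr oq on IH pqn].
  by rewrite jacobi1 andbF -jacobi_prime // jacobi1l.
have [q0 n0] : (0 < q /\ 0 < n)%N by lia.
move: pqn; rewrite coprimeMr => /andP[pq pn].
rewrite jacobiMr // PoszM legendreM // mulrACA IH // odd_halfM //.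
rewrite andb_addr signr_addb jacobi_prime //; congr (_ * _).
by rewrite legendre_reciprocity // -signr_odd oddM.
Qed.

(** * Sign rules and exhaustive checks over matrices of determinant 1 modulo n *)

Lemma Zp_int_eq (n : nat) (x y : int) : (1 < n)%N ->
  (x%:~R = y%:~R :> 'Z_n) <-> (x = y %[mod n%:Z])%Z.
Proof.
move=> n1; have eq0 (z : int) : (z%:~R == 0 :> 'Z_n) = (n%:Z %| z)%Z.
  have nat0 (m : nat) : (m%:R == 0 :> 'Z_n) = (n %| m)%N.
    by rewrite -val_eqE /= val_Zp_nat.
  case: z => m; first by rewrite -pmulrn nat0.
  by rewrite NegzE rmorphN /= oppr_eq0 dvdzE abszN -pmulrn nat0.
have E : (x%:~R == y%:~R :> 'Z_n) = (x == y %[mod n%:Z])%Z.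
  by rewrite eqz_mod_dvd -eq0 rmorphB /= subr_eq0.
by split=> /eqP; [rewrite E | rewrite -E] => /eqP.
Qed.

Lemma coprime_bezout (a b c d : nat) : (a * d = 1 + b * c)%N -> coprime a b.
Proof.
move=> e; have gb : (gcdn a b %| b * c)%N by rewrite dvdn_mulr // dvdn_gcdr.
by rewrite /coprime -dvdn1 -(dvdn_addl _ gb) -e dvdn_mulr // dvdn_gcdl.
Qed.

Lemma jacobi_addl (a b : nat) : odd (a + b) ->
  jacobi b%:Z (a + b) = (-1) ^+ (odd (a + b)./2) * jacobi a%:Z (a + b).
Proof.
move=> o; rewrite -jacobiN1 // -jacobiM // mulN1r; apply: eq_jacobi.
by apply/eqP; rewrite eqz_mod_dvd opprK -PoszD addnC.
Qed.

Lemma jacobi_swap (a b : nat) : odd a -> odd b -> coprime a b ->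
  jacobi a%:Z b = (-1) ^+ (odd a./2 && odd b./2) * jacobi b%:Z a.
Proof.
move=> oa ob ab; rewrite -jacobi_reciprocity // mulrAC -expr2.
by rewrite jacobi_sqr // ?mul1r // coprimezE coprime_sym.
Qed.

Lemma jacobi_mod (a b k : nat) : jacobi (a + k * b)%:Z b = jacobi a%:Z b.
Proof.
by apply: eq_jacobi; rewrite PoszD PoszM; apply/eqP; rewrite eqz_mod_dvd;
  apply/dvdzP; exists k%:Z; rewrite addrC addKr.
Qed.

Lemma jacobi_signE (a b : nat) : odd b -> coprime a b ->
  exists e : bool, jacobi a%:Z b = (-1) ^+ e.
Proof.
move=> ob ab; case: (@jacobi_sign a%:Z b ob); first by rewrite coprimezE.
  by exists false.
by exists true.
Qed.

Lemma all_Zp (n : nat) (P : pred 'I_n.+2) :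
  all P [seq inZp i | i <- iota 0 n.+2] -> forall x, P x.
Proof.
move/allP => h x; apply: h; apply/mapP; exists (val x); last by rewrite valZpK.
by rewrite mem_iota /=.
Qed.

(* The tests are nested conditionals rather than implications, since
   call-by-value evaluation would compute both sides of an implication. *)
Definition det1_all (n : nat) (Q : 'Z_n -> 'Z_n -> bool)
    (P : 'Z_n -> 'Z_n -> 'Z_n -> 'Z_n -> bool -> bool) :=
  let s := [seq inZp i : 'Z_n | i <- iota 0 (Zp_trunc n).+2] in
  all (fun a => all (fun b => if Q a b then all (fun c => all (fun d =>
    if a * d == 1 + b * c then P a b c d true && P a b c d false else true)
    s) s else true) s) s.

(** The boolean e stands for an unknown Jacobi symbol (-1)^e, so both signs are checked. *)
Lemma det1_allP (n : nat) Q P : @det1_all n Q P ->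
  forall (a b c d : nat) (e : bool), (a * d = 1 + b * c)%N -> Q a%:R b%:R ->
  P a%:R b%:R c%:R d%:R e.
Proof.
move=> h a b c d e det ab; have := all_Zp (all_Zp h a%:R) b%:R.
rewrite ab => h2; have := all_Zp (all_Zp h2 c%:R) d%:R.
by rewrite -!natrM det natrD eqxx => /andP[]; case: e.
Qed.

Lemma oddZ8 (m : nat) : odd (m%:R : 'Z_8) = odd m.
Proof. by rewrite val_Zp_nat // odd_mod. Qed.

(** The parity of [m./2] depends only on m modulo 4, so the signs from reciprocity are visible in
    ['Z_8]. *)
Lemma odd_halfZ8 (m : nat) : odd (m%:R : 'Z_8)./2 = odd m./2.
Proof. by rewrite val_Zp_nat //; lia. Qed.

Lemma odd_sqrZ8 (m : nat) : odd m -> m%:R * m%:R = 1 :> 'Z_8.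
Proof.
have /all_Zp h : all (fun x : 'Z_8 => odd x ==> (x * x == 1))
  [seq inZp i | i <- iota 0 8] by vm_compute.
by have := h m%:R; rewrite oddZ8 => /implyP h' /h'/eqP.
Qed.

(** * Invariance of the formulas for T under the generators U and L *)

(* (a c; b d) is the matrix product described above, and t its value of T. *)
Definition cf_inv (a b c d : nat) (t : int) : Prop :=
  [/\ (a * d = 1 + b * c)%N,
      t%:~R = - (a%:R + d%:R) * b%:R - a%:R * c%:R * (1 - b%:R ^+ 2) :> 'Z_3
    & if odd b then
        t%:~R = b%:R * (1 + 2 * (jacobi a%:Z b)%:~R - a%:R - d%:R) :> 'Z_8
      else t%:~R + 1 = (a%:R + b%:R) *
        (1 + 2 * (jacobi a%:Z (a + b))%:~R - a%:R - d%:R - c%:R) :> 'Z_8].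

Lemma cf_inv1 : cf_inv 1 0 0 1 0.
Proof. by split => //=; rewrite ?jacobi1; apply/eqP; vm_compute. Qed.

(** For odd b the symbol is unchanged and b^2 = 1 modulo 8 accounts for the drop by 1. For even b,
    reciprocity turns (a+b / a+2b) into (a+2b / a+b) = (b / a+b), and b = -a modulo a + b. *)
Lemma cf_invU (a b c d : nat) (t : int) : cf_inv a b c d t ->
  cf_inv (a + b) b (c + d) d (t - 1).
Proof.
move=> [det h3 h8]; have det' : ((a + b) * d = 1 + b * (c + d))%N by nia.
split=> //.
  have := @det1_allP 3 (fun _ _ => true) (fun a b c d _ =>
    (- (a + d) * b - a * c * (1 - b ^+ 2) - 1
     == - (a + b + d) * b - (a + b) * (c + d) * (1 - b ^+ 2))).
  move=> /(_ ltac:(vm_compute; reflexivity) a b c d true det isT).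
  by rewrite rmorphB /= h3 !natrD => /eqP.
case: ifP h8 => ob h8.
  have -> : jacobi (a + b)%:Z b = jacobi a%:Z b.
    by rewrite -(jacobi_mod a b 1) mul1n.
  rewrite rmorphB /= h8 natrD.
  by rewrite -[X in b%:R * _ - X](odd_sqrZ8 ob); ring.
have oa : odd a by have := congr1 odd det; rewrite oddD !oddM ob; case: odd.
have oab : odd (a + b) by rewrite oddD oa ob.
have oabb : odd (a + b + b) by rewrite oddD oab ob.
have J : jacobi (a + b)%:Z (a + b + b) =
    (-1) ^+ (odd (a + b)./2 && odd (a + b + b)./2)
    * ((-1) ^+ (odd (a + b)./2) * jacobi a%:Z (a + b)).
  rewrite jacobi_swap //; last first.
    (* The witnesses form the second column of L U (a c; b d). *)
    by apply: (@coprime_bezout _ _ (c + d) (c + d + d)); nia.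
  by rewrite -jacobi_addl // [(a + b + b)%N]addnC -[X in (b + X)%N]mul1n jacobi_mod.
have [e E] : exists e : bool, jacobi a%:Z (a + b) = (-1) ^+ e.
  by apply: jacobi_signE => //; apply: (@coprime_bezout _ _ c (c + d)); nia.
rewrite J rmorphB /= subrK -(addrK 1 t%:~R) h8 E !rmorphM /= !rmorph_sign.
have := @det1_allP 8 (fun _ b => ~~ odd b) (fun a b c d e =>
  ((a + b) * (1 + 2 * (-1) ^+ e - a - d - c) - 1 ==
   (a + b + b) * (1 + 2 * ((-1) ^+ (odd (a + b)%R./2 && odd (a + b + b)%R./2)
    * ((-1) ^+ (odd (a + b)%R./2) * (-1) ^+ e)) - (a + b) - d - (c + d)))).
move=> /(_ ltac:(vm_compute; reflexivity) a b c d e det).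
by rewrite oddZ8 ob -!natrD !odd_halfZ8 !natrD => /(_ isT)/eqP.
Qed.

(** For even b the old formula already concerns a + b. For a and b odd, two swaps lead from (a /
    2a+b) through (b / a) to (a / b). For a even and b odd, a cannot be swapped directly, so (a /
    a+b) is first replaced by (b / a+b) up to sign. *)
Lemma cf_invL (a b c d : nat) (t : int) : cf_inv a b c d t ->
  cf_inv a (a + b) c (c + d) (t + 1).
Proof.
move=> [det h3 h8]; have det' : (a * (c + d) = 1 + (a + b) * c)%N by nia.
split=> //.
  have := @det1_allP 3 (fun _ _ => true) (fun a b c d _ =>
    (- (a + d) * b - a * c * (1 - b ^+ 2) + 1
     == - (a + (c + d)) * (a + b) - a * c * (1 - (a + b) ^+ 2))).
  move=> /(_ ltac:(vm_compute; reflexivity) a b c d true det isT).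
  by rewrite rmorphD /= h3 !natrD => /eqP.
case ob: (odd b) h8 => h8; last first.
  have oa : odd a by have := congr1 odd det; rewrite oddD !oddM ob; case: odd.
  rewrite oddD oa ob /= rmorphD /= h8 !natrD; congr (_ * _).
  by rewrite opprD addrA [LHS]addrAC.
have ab := coprime_bezout det.
have [e E] : exists e : bool, jacobi a%:Z b = (-1) ^+ e by apply: jacobi_signE.
case oa: (odd a); rewrite oddD oa ob /=.
  have o2 : odd (a + (a + b)) by rewrite !oddD oa ob.
  have J : jacobi a%:Z (a + (a + b)) =
      (-1) ^+ (odd a./2 && odd (a + (a + b))./2)
      * ((-1) ^+ (odd b./2 && odd a./2) * jacobi a%:Z b).
    rewrite jacobi_swap //; last first.
      by apply: (@coprime_bezout _ _ c (c + (c + d))); nia.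
    rewrite -(jacobi_swap (a := b) (b := a)) // 1?coprime_sym //.
    have -> : (a + (a + b) = b + 2 * a)%N by lia.
    by rewrite jacobi_mod.
  rewrite J rmorphD /= h8 E !rmorphM /= !rmorph_sign.
  have := @det1_allP 8 (fun a b => odd a && odd b) (fun a b c d e =>
    (b * (1 + 2 * (-1) ^+ e - a - d) + 1 + 1 ==
     (a + (a + b)) * (1 + 2 * ((-1) ^+ (odd a./2 && odd (a + (a + b))%R./2)
      * ((-1) ^+ (odd b./2 && odd a./2) * (-1) ^+ e)) - a - (c + d) - c))).
  move=> /(_ ltac:(vm_compute; reflexivity) a b c d e det).
  by rewrite !oddZ8 oa ob -!natrD !odd_halfZ8 !natrD => /(_ isT)/eqP.
have oab : odd (a + b) by rewrite oddD oa ob.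
have J : jacobi a%:Z (a + b) = (-1) ^+ (odd (a + b)./2)
    * ((-1) ^+ (odd b./2 && odd (a + b)./2) * jacobi a%:Z b).
  rewrite -(jacobi_mod a b 1) mul1n -(jacobi_swap (a := b) (b := (a + b)%N)) //; last first.
    by rewrite coprime_sym; apply: (@coprime_bezout _ _ (c + d) d); nia.
  by rewrite [(a + b)%N]addnC jacobi_addl // addnC.
rewrite J rmorphD /= h8 E !rmorphM /= !rmorph_sign.
have := @det1_allP 8 (fun a b => ~~ odd a && odd b) (fun a b c d e =>
  (b * (1 + 2 * (-1) ^+ e - a - d) + 1 ==
   (a + b) * (1 + 2 * ((-1) ^+ (odd (a + b)%R./2)
    * ((-1) ^+ (odd b./2 && odd (a + b)%R./2) * (-1) ^+ e)) - a - (c + d)))).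
move=> /(_ ltac:(vm_compute; reflexivity) a b c d e det).
by rewrite !oddZ8 oa ob -!natrD !odd_halfZ8 !natrD => /(_ isT)/eqP.
Qed.

Lemma cf_inv_iterU (x a b c d : nat) (t : int) : cf_inv a b c d t ->
  cf_inv (a + x * b) b (c + x * d) d (t - x%:Z).
Proof.
move=> h; elim: x => [|x IH]; first by rewrite !mul0n !addn0 subr0.
have -> : (a + x.+1 * b = a + x * b + b)%N by lia.
have -> : (c + x.+1 * d = c + x * d + d)%N by lia.
have -> : t - x.+1%:Z = t - x%:Z - 1 by lia.
exact: cf_invU.
Qed.

Lemma cf_inv_iterL (y a b c d : nat) (t : int) : cf_inv a b c d t ->
  cf_inv a (b + y * a) c (d + y * c) (t + y%:Z).
Proof.
move=> h; elim: y => [|y IH]; first by rewrite !mul0n !addn0 addr0.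
have -> : (b + y.+1 * a = a + (b + y * a))%N by lia.
have -> : (d + y.+1 * c = c + (d + y * c))%N by lia.
have -> : t + y.+1%:Z = t + y%:Z + 1 by lia.
exact: cf_invL.
Qed.

(** * From continued fractions to matrices *)

Definition alt_sum (q : seq int) : int :=
  \sum_(k < size q) (-1) ^+ k.+1 * q`_k.

Lemma alt_sum_cons2 (x y : int) (q : seq int) :
  alt_sum [:: x, y & q] = alt_sum q + y - x.
Proof.
rewrite /alt_sum /= !big_ord_recl /= expr1 mulN1r expr2 mulN1r opprK mul1r.
rewrite addrA addrC [- x + y]addrC addrA; congr (_ + y - x).
by apply: eq_bigr => k _; rewrite /bump /= !add1n exprS mulN1r exprS mulN1r opprK.
Qed.

(** The expansion is taken without q_0, which may be negative while the matrices have natural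
    entries. The bounds on c and d serve to identify d with a*. *)
Lemma cf_inv_seqL (y : int) (q : seq int) : ~~ odd (size q) ->
  0 < y -> all (fun x => 0 < x) q ->
  exists a b c d : nat, [/\ cf_inv a b c d (alt_sum q + y),
    y%:~R + (cf_val q)^-1 = b%:R / a%:R, (0 < b)%N, (c <= a)%N & (d <= b)%N].
Proof.
(* The identity matrix has b = 0 and d = 1, so only [d + c <= b + a] can be assumed; since y' is at
   least 1, applying L^y' turns it into the bound d <= b. *)
have step y' q' : 0 < y' -> (exists a b c d : nat,
    [/\ cf_inv a b c d (alt_sum q'), (cf_val q')^-1 = b%:R / a%:R,
      (c <= a)%N & (d + c <= b + a)%N]) ->
  exists a b c d : nat, [/\ cf_inv a b c d (alt_sum q' + y'),
    y'%:~R + (cf_val q')^-1 = b%:R / a%:R, (0 < b)%N, (c <= a)%N & (d <= b)%N].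
  case: y' => // y' y0 [a] [b] [c] [d] [inv val ca dc].
  have a0 : (0 < a)%N by case: inv => det _ _; case: (a) det.
  exists a, (b + y' * a)%N, c, (d + y' * c)%N.
  split=> //; [exact: cf_inv_iterL | | nia | nia].
  have aF : a%:R != 0 :> rat by rewrite pnatr_eq0; lia.
  by rewrite val -pmulrn natrD natrM addrC mulrDl mulfK.
move=> sq y0 qp; apply: (step) => //.
have [n nq] := ubnP (size q).
elim: n q nq sq qp {y y0} => // n IH [|x [|y q]] //= nq.
  exists 1%N, 0%N, 0%N, 1%N; split; rewrite ?invr0 ?mul0r //.
  by rewrite /alt_sum big_ord0; apply: cf_inv1.
rewrite negbK => sq /and3P[x0 y0 qp].
have [a [b [c [d [inv val b0 ca db]]]]] := step y q y0 (IH q ltac:(lia) sq qp).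
case: x x0 => // x x0; exists (a + x * b)%N, b, (c + x * d)%N, d; split; try nia.
  by rewrite alt_sum_cons2; apply: cf_inv_iterU.
have a0 : (0 < a)%N by case: inv => det _ _; case: (a) det.
have aF : a%:R != 0 :> rat by rewrite pnatr_eq0; lia.
have bF : b%:R != 0 :> rat by rewrite pnatr_eq0; lia.
rewrite val -pmulrn invf_div -[RHS]invf_div; congr (_^-1).
by rewrite natrD natrM mulrDl mulfK // addrC.
Qed.

Lemma T_matrix (a : int) (b : nat) : (0 < b)%N -> coprimez a b%:Z ->
  exists (a' c d : nat) (x t : int), [/\ cf_inv a' b c d t,
    a = a'%:Z + x * b%:Z, T a b = t - x & (d <= b)%N].
Proof.
move=> b0 ab; have /odd_cfP := erefl (odd_cf a b).
rewrite /T; move: (odd_cf a b) => [|x [|y q]] // /and3P[/= sq /andP[y0 qp]].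
have [a' [b' [c [d [inv -> b0' ca db]]]]] := cf_inv_seqL sq y0 qp.
rewrite invf_div => /eqP e.
have bF : b%:R != 0 :> rat by rewrite pnatr_eq0; lia.
have bF' : b'%:R != 0 :> rat by rewrite pnatr_eq0; lia.
have cross : (a'%:Z + x * b'%:Z) * b%:Z = a * b'%:Z.
  apply: (@intr_inj rat); rewrite !rmorphM rmorphD rmorphM /= -!pmulrn.
  have -> : a%:~R = (x%:~R + a'%:R / b'%:R) * b%:R :> rat by rewrite e mulfVK.
  by field.
(* Both fractions are reduced, so the denominators divide each other. *)
have bb' : b = b'.
  have [det _ _] := inv.
  have ab' : coprimez (a'%:Z + x * b'%:Z) b'%:Z.
    rewrite coprimez_sym /coprimez addrC gcdzMDl -/(coprimez _ _) coprimez_sym.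
    exact: coprime_bezout det.
  apply/eqP; rewrite eqn_dvd; apply/andP; split.
    have : (b%:Z %| a * b'%:Z)%Z by rewrite -cross dvdz_mull.
    by rewrite Gauss_dvdzr // coprimez_sym.
  have : (b'%:Z %| (a'%:Z + x * b'%:Z) * b%:Z)%Z by rewrite cross dvdz_mull.
  by rewrite Gauss_dvdzr // coprimez_sym.
rewrite -bb' in inv db bF' cross.
exists a', c, d, x, (alt_sum q + y); split=> //; last exact: alt_sum_cons2.
by apply/esym/(mulIf _ cross); lia.
Qed.

(** * The product b T modulo 8, 3 and 9 *)

Lemma cf_inv_odd (a b c d : nat) (t : int) : cf_inv a b c d t -> odd b ->
  (b%:Z * t = 1 + 2 * jacobi a%:Z b - a%:Z - d%:Z %[mod 8])%Z.
Proof.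
move=> [_ _ h8] ob; rewrite ob in h8; apply/(Zp_int_eq _ _ (n := 8)) => //.
rewrite rmorphM !rmorphB rmorphD rmorphM /= h8 -!pmulrn mulrA odd_sqrZ8 //.
by rewrite mul1r.
Qed.

(** Multiplication by an even b removes the Jacobi symbol, because 2 b = -2 b modulo 8. *)
Lemma cf_inv_even (a b c d : nat) (t : int) : cf_inv a b c d t -> ~~ odd b ->
  (b%:Z * t = (if (b %% 4 == 2)%N || (a %% 4 == 3)%N then 6 else 2)
              - a%:Z - d%:Z %[mod 8])%Z.
Proof.
move=> [det _ h8] ob; rewrite (negPf ob) in h8.
apply/(Zp_int_eq _ _ (n := 8)) => //.
have oab : odd (a + b).
  by have := congr1 odd det; rewrite !oddD !oddM (negPf ob); case: odd.
have [e E] : exists e : bool, jacobi a%:Z (a + b) = (-1) ^+ e.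
  by apply: jacobi_signE => //; apply: (@coprime_bezout _ _ c (c + d)); nia.
rewrite E rmorph_sign in h8.
have := @det1_allP 8 (fun _ b => ~~ odd b) (fun a b c d e =>
  (b * ((a + b) * (1 + 2 * (-1) ^+ e - a - d - c) - 1) ==
   (if (b %% 4 == 2)%N || (a %% 4 == 3)%N then 6 else 2) - a - d)).
move=> /(_ ltac:(vm_compute; reflexivity) a b c d e det).
rewrite oddZ8 -h8 addrK !val_Zp_nat // !modn_dvdm // => /(_ ob)/eqP.
by rewrite rmorphM !rmorphB /= -!pmulrn => ->; case: ifP.
Qed.

Lemma cf_inv_ndvd3 (a b c d : nat) (t : int) : cf_inv a b c d t ->
  ~~ (3 %| b)%N -> (b%:Z * t = - a%:Z - d%:Z %[mod 3])%Z.
Proof.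
move=> [det h3 _] b3; apply/(Zp_int_eq _ _ (n := 3)) => //.
have := @det1_allP 3 (fun _ b => b != 0) (fun a b c d _ =>
  (b * (- (a + d) * b - a * c * (1 - b ^+ 2)) == - a - d)).
move=> /(_ ltac:(vm_compute; reflexivity) a b c d true det).
rewrite -h3 -val_eqE /= val_Zp_nat // => /(_ b3)/eqP.
by rewrite rmorphM rmorphB rmorphN /= -!pmulrn.
Qed.

(** Here t = -a c modulo 3, hence b t = -a b c = -a (a d - 1) modulo 9; both a and d are [eps]
    modulo 3. *)
Lemma cf_inv_dvd3 (a b c d : nat) (t eps : int) : cf_inv a b c d t ->
  (3 %| b)%N -> eps = 1 \/ eps = -1 -> (a%:Z = eps %[mod 3])%Z ->
  (b%:Z * t = 2 * eps - a%:Z - d%:Z %[mod 9])%Z.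
Proof.
move=> [det h3 _] b3 e1 ae.
have b0 : b%:R = 0 :> 'Z_3 by apply/val_inj; rewrite /= val_Zp_nat //; apply/eqP.
have {h3} : (t = - (a%:Z * c%:Z) %[mod 3])%Z.
  apply/(Zp_int_eq _ _ (n := 3)) => //.
  rewrite h3 b0 rmorphN rmorphM /= -!pmulrn; ring.
move/eqP; rewrite eqz_mod_dvd => /dvdzP[n tE].
move/eqP: ae; rewrite eqz_mod_dvd => /dvdzP[k aE].
have [m bE] := dvdnP b3.
have [{}aE {}tE {}bE] : [/\ a%:Z = eps + k * 3, t = n * 3 - a%:Z * c%:Z
  & b%:Z = m%:Z * 3] by split; lia.
have detZ : a%:Z * d%:Z = 1 + b%:Z * c%:Z by lia.
have dE : d%:Z = eps + (eps * m%:Z * c%:Z - eps * k * d%:Z) * 3.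
  by move: detZ; rewrite aE bE; case: e1 => ->; lia.
set l := (X in d%:Z = eps + X * 3) in dE.
have btE : b%:Z * t = m%:Z * n * 9 - a%:Z * (a%:Z * d%:Z - 1).
  by rewrite tE detZ bE; ring.
apply/eqP; rewrite eqz_mod_dvd; apply/dvdzP.
(* With eps^2 = 1, a = eps + 3k and d = eps + 3l: a^2 d = d + 6k + 9 (2 eps k l + k^2 d), and a - 6k
   = 2 eps - a. *)
exists (m%:Z * n - 2 * eps * k * l - k ^+ 2 * d%:Z).
move: l dE => l dE; rewrite btE aE dE.
by case: e1 => ->; ring.
Qed.

(** * Assembling the congruences modulo 24 and 72 *)

Theorem theorem2 (b : nat) (a : int) (astar : nat) :
  (0 < b)%N -> coprimez a b%:Z ->
  (1 <= astar <= b.-1)%N -> (a * astar%:Z = 1 %[mod b%:Z])%Z ->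
  [/\ (odd b ->
        (~~ (3 %| b)%N ->
          (b%:Z * T a b = 9 + 18 * jacobi a b - a - astar%:Z %[mod 24])%Z)
        /\ ((3 %| b)%N -> forall eps : int, eps = 1 \/ eps = -1 ->
          (a = eps %[mod 3])%Z ->
          (b%:Z * T a b
             = 9 + 18 * jacobi a b - 16 * eps - a - astar%:Z %[mod 72])%Z)),
      ((b = 2 %[mod 4])%N \/ (b = 0 %[mod 4])%N /\ (a = 3 %[mod 4])%Z ->
        (~~ (3 %| b)%N ->
          (b%:Z * T a b = 6 - a - astar%:Z %[mod 24])%Z)
        /\ ((3 %| b)%N -> forall eps : int, eps = 1 \/ eps = -1 ->
          (a = eps %[mod 3])%Z ->
          (b%:Z * T a b = 54 - 16 * eps - a - astar%:Z %[mod 72])%Z))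
    & ((b = 0 %[mod 4])%N /\ (a = 1 %[mod 4])%Z ->
        (~~ (3 %| b)%N ->
          (b%:Z * T a b = 18 - a - astar%:Z %[mod 24])%Z)
        /\ ((3 %| b)%N -> forall eps : int, eps = 1 \/ eps = -1 ->
          (a = eps %[mod 3])%Z ->
          (b%:Z * T a b = 18 - 16 * eps - a - astar%:Z %[mod 72])%Z))].
Proof.
move=> b0 ab hs inv_as; have [a' [c [d [x [t [inv aE TE db]]]]]] := T_matrix b0 ab.
have [det _ _] := inv.
have d0 : (0 < d)%N by case: (d) det => //; rewrite muln0.
(* Both are inverses of a modulo b, and 1 <= d <= b together with 1 <= a* < b keeps their difference
   below b in absolute value. *)
have dE : d = astar.
  have : (b%:Z %| a * (d%:Z - astar%:Z))%Z.
    rewrite mulrBr -eqz_mod_dvd inv_as eqz_mod_dvd aE; apply/dvdzP.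
    exists (c%:Z + x * d%:Z); lia.
  rewrite Gauss_dvdzr 1?coprimez_sym // => /dvdzP[k kE].
  have [k0|k0|k0] := ltgtP k 0; [nia | nia | rewrite k0 in kE; lia].
rewrite -dE TE.
have J : jacobi a b = jacobi a'%:Z b.
  apply: eq_jacobi; rewrite aE; apply/eqP; rewrite eqz_mod_dvd.
  by apply/dvdzP; exists x; lia.
have a4 : (4 %| b)%N -> (a = a' %[mod 4])%Z.
  case/dvdnP => m bE; rewrite aE bE; apply/eqP; rewrite eqz_mod_dvd.
  by apply/dvdzP; exists (x * m%:Z); lia.
(* Passing from a' to a = a' + x b lowers both b T and -a by x b, so the congruences for a' carry
   over. *)
have bT : b%:Z * (t - x) = b%:Z * t - x * b%:Z by ring.
have no3 := cf_inv_ndvd3 inv.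
have is3 (h3 : (3 %| b)%N) (eps : int) (e1 : eps = 1 \/ eps = -1)
    (ae : (a = eps %[mod 3])%Z) :
    (b%:Z * t = 2 * eps - a'%:Z - d%:Z %[mod 9])%Z.
  apply: (cf_inv_dvd3 inv h3 e1); rewrite -ae aE.
  case/dvdnP: h3 => m ->; apply/eqP; rewrite eqz_mod_dvd.
  by apply/dvdzP; exists (- (x * m%:Z)); lia.
move: (b%:Z * t) (x * b%:Z) bT no3 is3 (cf_inv_odd inv) (cf_inv_even inv) aE.
move=> z w -> no3 is3 h_odd h_even aE.
split.
- move=> ob; have {h_odd} := h_odd ob; rewrite -J; move: (jacobi a b) => j h8.
  (* Chinese remainders: 9 + 18 j is 1 + 2 j modulo 8 and 0 modulo 9, while -16 eps is 0 modulo 8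
     and 2 eps modulo 9. *)
  split=> [/no3|/is3 h eps e1 /(h _ e1)]; move: h8 aE; clear; lia.
- move=> h4; have h8 : (z = 6 - a'%:Z - d%:Z %[mod 8])%Z.
    rewrite h_even; last by lia.
    case: ifP => //.
    case: h4 => [->//|[b4 a3]]; have := a4 ltac:(lia); lia.
  split=> [/no3|/is3 h eps e1 /(h _ e1)]; move: h8 aE; clear; lia.
- move=> [b4 a1]; have h8 : (z = 2 - a'%:Z - d%:Z %[mod 8])%Z.
    rewrite h_even; last by lia.
    case: ifP => //; have := a4 ltac:(lia); lia.
  split=> [/no3|/is3 h eps e1 /(h _ e1)]; move: h8 aE; clear; lia.
Qed.
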